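(* Fix one of the four types of finite elements (linear, bilinear, Crouzeix-Raviart, rotated-$Q_1$) and let the unisolvence conditions stated in the context hold, with IFE shape functions $\phi^P_{i,T}$ and their pieces $\phi^{P\pm}_{i,T}\in\Pi_T$. Then on every interface element $T\in\mathcal T_h^i$, for arbitrary points $\overline X_i\in l$, $i\in\mathcal I$, $$\sum_{i\in\mathcal I}(M_i-X)\phi^{P-}_{i,T}(X)+\sum_{i\in\mathcal I^+}(\overline M^-(F)-I)^T(M_i-\overline X_i)\phi^{P-}_{i,T}(X)=0,\quad \forall X\in T^-,$$ $$\sum_{i\in\mathcal I}(M_i-X)\phi^{P+}_{i,T}(X)+\sum_{i\in\mathcal I^-}(\overline M^+(F)-I)^T(M_i-\overline X_i)\phi^{P+}_{i,T}(X)=0,\quad \forall X\in T^+,$$ and, for $d=1,2$, $$\sum_{i\in\mathcal I}(M_i-X)\partial_d\phi^{P-}_{i,T}(X)+\sum_{i\in\mathcal I^+}(\overline M^-(F)-I)^T(M_i-\overline X_i)\partial_d\phi^{P-}_{i,T}(X)-\mathbf e_d=0,\quad \forall X\in T^-,$$ $$\sum_{i\in\mathcal I}(M_i-X)\partial_d\phi^{P+}_{i,T}(X)+\sum_{i\in\mathcal I^-}(\overline M^+(F)-I)^T(M_i-\overline X_i)\partial_d\phi^{P+}_{i,T}(X)-\mathbf e_d=0,\quad \forall X\in T^+,$$ where $\partial_1=\partial_x$, $\partial_2=\partial_y$ and $\mathbf e_d$ is the standard $d$-th unit vector of $\mathbb R^2$.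
   Context: Mesh and interface. $\Omega\subset\mathbb R^2$ is a bounded domain that is a union of finitely many rectangles; a curve $\Gamma$ separates $\Omega$ into subdomains $\Omega^-,\Omega^+$. $\mathcal T_h$ is a Cartesian triangular or rectangular mesh of $\Omega$ with maximum edge length $h$; a typical element has vertices $A_1=(0,0),A_2=(h,0),A_3=(h,h)$ (triangle), or additionally $A_4=(0,h)$ (rectangle). An element whose interior meets $\Gamma$ is an interface element; $\mathcal T_h^i$ is the set of these. Standing hypotheses: $\Gamma$ meets an edge of an element in at most two points unless the edge is part of $\Gamma$; if $\Gamma$ meets the boundary of an element at two points, these are on different edges; $\Gamma$ is piecewise $C^2$, and its portion in each interface element is $C^2$. For $T\in\mathcal T_h^i$: $T^s=T\cap\Omega^s$, $s=\pm$; $D,E$ are the intersection points of $\Gamma$ with $\partial T$; $l$ is the line through $D$ and $E$ with unit normal $\bar{\mathbf n}=(\bar n_x,\bar n_y)$; $\mathbf n(\widetilde X)=(\tilde n_x(\widetilde X),\tilde n_y(\widetilde X))$ is the unit normal of $\Gamma$ at $\widetilde X\in\Gamma\cap T$; all normals are oriented from $T^-$ to $T^+$. In the local coordinates with origin $D$ and first axis along $l$, $\Gamma\cap T$ is a graph $\{(\xi,\omega(\xi)):\xi\in[0,\xi_E]\}$, where $E=(\xi_E,0)$. $\kappa$ is the maximum curvature of $\Gamma$. Coefficients: $\beta^\pm>0$ are constants with $\beta^+\ge\beta^-$, and $\rho=\beta^-/\beta^+\le 1$. Finite elements: $\Pi_T=\mathrm{Span}\{1,x,y\}$ (linear or Crouzeix-Raviart,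 triangles), $\mathrm{Span}\{1,x,y,xy\}$ (bilinear, rectangles), or $\mathrm{Span}\{1,x,y,x^2-y^2\}$ (rotated-$Q_1$, rectangles). $\mathcal I=\{1,2,3\}$ for triangles and $\{1,2,3,4\}$ for rectangles. The nodes $M_i$ are the vertices of $T$ (linear, bilinear) or the midpoints of the edges of $T$ (Crouzeix-Raviart, rotated-$Q_1$). $\mathcal I$ is partitioned into $\mathcal I^\pm=\{i: M_i\in T^\pm\}$. For $p\in\Pi_T$, $T$ rectangular, $d(p)$ is the coefficient of its second degree term. Unisolvence conditions. Fixed $\epsilon\in(0,\sqrt2/2)$, $\bar\kappa\in(0,1]$ with $h<\min\{\sqrt{\bar\kappa}/(\sqrt2(1+(1-2\epsilon^2)^{-3/2})\kappa),\ \epsilon/\kappa\}$; in the bilinear case $\sqrt{\bar\kappa}<\frac1{4\sqrt2}$; in the rotated-$Q_1$ case $\sqrt{\bar\kappa}\le\frac{\rho(1-\lambda)}{4-(3+\lambda)\rho}$ for some $\lambda\in(0,1)$. On each $T\in\mathcal T_h^i$ a point $F\in\Gamma\cap T$ is fixed with $\mathbf n(F)=\bar{\mathbf n}$ (linear, Crouzeix-Raviart), with orthogonal projection $F_\bot$ onto $l$ equal to the midpoint of $\overline{DE}$ (bilinear), arbitrary (rotated-$Q_1$). IFE shape functions. Under these conditions $\phi^P_{i,T}$ is the unique function equal to $\phi^{P-}_{i,T}\in\Pi_T$ on $T^-$ and $\phi^{P+}_{i,T}\in\Pi_T$ on $T^+$ with: $\phi^{P-}_{i,T}|_l=\phi^{P+}_{i,T}|_l$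 and, for rectangular $T$, $d(\phi^{P-}_{i,T})=d(\phi^{P+}_{i,T})$; $\beta^-\nabla\phi^{P-}_{i,T}(F)\cdot\mathbf n(F)=\beta^+\nabla\phi^{P+}_{i,T}(F)\cdot\mathbf n(F)$; $\phi^P_{i,T}(M_j)=\delta_{ij}$, $j\in\mathcal I$. Matrices. For $\widetilde X\in\Gamma\cap T$, $\overline N^s(\widetilde X)=\begin{pmatrix}\bar n_y&-\bar n_x\\ \beta^s\tilde n_x(\widetilde X)&\beta^s\tilde n_y(\widetilde X)\end{pmatrix}$, $s=\pm$ (nonsingular under the smallness condition on $h$), $\overline M^+(\widetilde X)=(\overline N^-(\widetilde X))^{-1}\overline N^+(\widetilde X)$, $\overline M^-(\widetilde X)=(\overline N^+(\widetilde X))^{-1}\overline N^-(\widetilde X)$. Points and gradients are column vectors; $I$ is the $2\times2$ identity. *)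

(* Defs.v *)
From HB Require Import structures.
From mathcomp Require Import all_boot all_order all_algebra.
From mathcomp Require Import all_classical all_reals all_analysis.

Set Implicit Arguments.
Unset Strict Implicit.
Unset Printing Implicit Defensive.

Import Order.TTheory GRing.Theory Num.Theory.
Import numFieldNormedType.Exports.

Local Open Scope classical_set_scope.
Local Open Scope ring_scope.

(* The topology of 'cV[R]_2 is that of the max norm; Euclidean lengths and
   angles go through dot. *)
Notation pt R := ('cV[R]_2).

Definition xc (R : realType) (X : pt R) : R := X 0 0.
Definition yc (R : realType) (X : pt R) : R := X 1 0.
Definition mkpt (R : realType) (x y : R) : pt R :=
  \col_(i < 2) (if i == 0 then x else y).
Definition dot (R : realType) (X Y : pt R) : R := xc X * xc Y + yc X * yc Y.
Definition enorm (R : realType) (X : pt R) : R := Num.sqrt (dot X X).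
Definition unitv (R : realType) (d : 'I_2) : pt R := delta_mx d 0.
Definition segment (R : realType) (A B : pt R) : set (pt R) :=
  [set (1 - t) *: A + t *: B | t in `[0, 1]].
Definition line (R : realType) (A B : pt R) : set (pt R) :=
  range (fun t : R => A + t *: (B - A)).

Definition domain (R : realType) (O : set (pt R)) : Prop :=
  [/\ open O, connected O & O !=set0].

(* Equality up to boundary: a rectangle is open, closed or neither. *)
Definition union_of_rectangles (R : realType) (O : set (pt R)) : Prop :=
  exists rs : seq (pt R * pt R),
    (forall r, r \in rs -> xc r.1 < xc r.2 /\ yc r.1 < yc r.2) /\
    closure O = [set X | exists2 r, r \in rs &
                   xc r.1 <= xc X <= xc r.2 /\ yc r.1 <= yc X <= yc r.2].

(* A C^2 function on a compact interval extends to a C^2 function on the line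
   (by its Taylor polynomials of degree 2 at the end points), so that
   derivatives at the end points are two-sided ones of the extension. *)
Definition C2 (R : realType) (f : R -> R) : Prop :=
  [/\ forall t, derivable f t 1,
      forall t, derivable (derive1 f) t 1 &
      continuous (derive1 (derive1 f))].

Definition xcoord (R : realType) (g : R -> pt R) (t : R) : R := xc (g t).
Definition ycoord (R : realType) (g : R -> pt R) (t : R) : R := yc (g t).

Definition velocity (R : realType) (g : R -> pt R) (t : R) : pt R :=
  mkpt (derive1 (xcoord g) t) (derive1 (ycoord g) t).
Definition acceleration (R : realType) (g : R -> pt R) (t : R) : pt R :=
  mkpt (derive1 (derive1 (xcoord g)) t) (derive1 (derive1 (ycoord g)) t).

Definition C2_arc (R : realType) (g : R -> pt R) (a b : R) : Prop :=
  [/\ C2 (xcoord g), C2 (ycoord g) &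
      forall t, a <= t <= b -> velocity g t != 0].

Definition curvature (R : realType) (g : R -> pt R) (t : R) : R :=
  `| xc (velocity g t) * yc (acceleration g t)
     - yc (velocity g t) * xc (acceleration g t) |
  / enorm (velocity g t) ^+ 3.

(* The break points are s`_0 < s`_1 < ...; piece k runs over
   [s`_k, s`_k.+1], and kappa is the maximum of the curvatures of the pieces. *)
Definition piecewise_C2_curve (R : realType) (G : set (pt R)) (kappa : R)
    : Prop :=
  exists (s : seq R) (g : nat -> R -> pt R),
    [/\ (1 < size s)%N /\ sorted <%R s,
        forall k, (k.+1 < size s)%N -> C2_arc (g k) s`_k s`_k.+1,
        forall k, (k.+2 < size s)%N -> g k s`_k.+1 = g k.+1 s`_k.+1,
        G = \bigcup_(k in [set k | (k.+1 < size s)%N])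
              g k @` `[s`_k, s`_k.+1] &
        (forall k t, (k.+1 < size s)%N -> s`_k <= t <= s`_k.+1 ->
           curvature (g k) t <= kappa) /\
        (exists k t, [/\ (k.+1 < size s)%N, s`_k <= t <= s`_k.+1 &
           curvature (g k) t = kappa])].

Record interface (R : realType) (Omega Om Op G : set (pt R)) (kappa : R)
    : Prop := Interface {
  if_domain : domain Omega;
  if_bounded : bounded_set Omega;
  if_rectangles : union_of_rectangles Omega;
  if_curve : piecewise_C2_curve G kappa;
  if_inside : G `<=` closure Omega;
  if_minus : domain Om;
  if_plus : domain Op;
  if_disjoint : Om `&` Op = set0;
  if_separates : Omega `\` G = Om `|` Op }.

Inductive fe_type := Linear | Bilinear | CrouzeixRaviart | RotatedQ1.

Definition is_rect (k : fe_type) : bool :=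
  match k with Linear | CrouzeixRaviart => false | _ => true end.

Definition vertex_nodes (k : fe_type) : bool :=
  match k with Linear | Bilinear => true | _ => false end.

(* Number of vertices, of edges, of nodes, and dimension of Pi_T. *)
Definition nloc (k : fe_type) : nat := (if is_rect k then 3 else 2).+1.

(* Cartesian mesh: the cells [xs_i, xs_i+1] x [ys_j, ys_j+1] for the (i, j) in
   gcells. In a triangular mesh, a cell is cut along one of its diagonals: the
   one through its lower right corner where ganti holds, else the other. *)
Record grid (R : realType) := Grid {
  gxs : seq R;
  gys : seq R;
  gcells : seq (nat * nat);
  ganti : nat * nat -> bool }.

Definition gwidth (R : realType) (g : grid R) (c : nat * nat) : R :=
  (gxs g)`_c.1.+1 - (gxs g)`_c.1.
Definition gheight (R : realType) (g : grid R) (c : nat * nat) : R :=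
  (gys g)`_c.2.+1 - (gys g)`_c.2.

(* The corners of a cell, counterclockwise from the lower left one. *)
Definition corner (R : realType) (g : grid R) (c : nat * nat) (q : nat)
    : pt R :=
  match q with
  | 0 => mkpt (gxs g)`_c.1 (gys g)`_c.2
  | 1 => mkpt (gxs g)`_c.1.+1 (gys g)`_c.2
  | 2 => mkpt (gxs g)`_c.1.+1 (gys g)`_c.2.+1
  | _ => mkpt (gxs g)`_c.1 (gys g)`_c.2.+1
  end.

(* An element is given by its vertices A_1, A_2, ... in cyclic order. A triangle
   consists of three consecutive corners of a cell, with the right angle at the
   second one, as (0,0), (h,0), (h,h). *)
Definition mesh_elt (R : realType) (k : fe_type) (g : grid R)
    : set ('I_(nloc k) -> pt R) :=
  [set A | exists (c : nat * nat) (q : nat),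
     [/\ c \in gcells g,
         if is_rect k then q = 0%N else (q < 4)%N /\ odd q = ganti g c &
         A = fun i : 'I_(nloc k) => corner g c ((q + i) %% 4)]].
Arguments mesh_elt {R} k g.

Definition elt_set (R : realType) (k : fe_type) (A : 'I_(nloc k) -> pt R)
    : set (pt R) :=
  [set X | exists t : 'I_(nloc k) -> R,
     [/\ forall i, 0 <= t i, \sum_i t i = 1 & X = \sum_i t i *: A i]].

Definition elt_edge (R : realType) (k : fe_type) (A : 'I_(nloc k) -> pt R)
    (i : 'I_(nloc k)) : set (pt R) := segment (A i) (A (ordS i)).

Definition elt_bnd (R : realType) (k : fe_type) (A : 'I_(nloc k) -> pt R)
    : set (pt R) := \bigcup_i elt_edge A i.

Definition node (R : realType) (k : fe_type) (A : 'I_(nloc k) -> pt R)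
    (i : 'I_(nloc k)) : pt R :=
  if vertex_nodes k then A i else 2^-1 *: (A i + A (ordS i)).

(* The closure accounts for nodes that lie on the interface or on the boundary
   of Omega. *)
Definition elt_part (R : realType) (k : fe_type) (A : 'I_(nloc k) -> pt R)
    (Os : set (pt R)) : set (pt R) := elt_set A `&` closure Os.

Definition interface_elt (R : realType) (k : fe_type)
    (A : 'I_(nloc k) -> pt R) (G : set (pt R)) : Prop :=
  (interior (elt_set A) `&` G) !=set0.

(* h is the maximum length of the edges parallel to the axes: a triangle of
   mesh size h is half a square of side h. *)
Record cartesian_mesh (R : realType) (k : fe_type) (Omega : set (pt R))
    (g : grid R) (h : R) : Prop := CartesianMesh {
  cm_xs : sorted <%R (gxs g);
  cm_ys : sorted <%R (gys g);
  cm_range : forall c, c \in gcells g ->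
    (c.1.+1 < size (gxs g))%N /\ (c.2.+1 < size (gys g))%N;
  cm_cover : closure Omega = \bigcup_(A in mesh_elt k g) elt_set A;
  cm_le : forall c, c \in gcells g -> gwidth g c <= h /\ gheight g c <= h;
  cm_max : exists2 c, c \in gcells g & gwidth g c = h \/ gheight g c = h }.

Record mesh_resolves (R : realType) (k : fe_type) (g : grid R)
    (G : set (pt R)) : Prop := MeshResolves {
  mr_edge : forall A, mesh_elt k g A -> forall i,
    elt_edge A i `<=` G \/
    (forall P Q S, (G `&` elt_edge A i) P -> (G `&` elt_edge A i) Q ->
       (G `&` elt_edge A i) S -> [\/ P = Q, Q = S | P = S]);
  mr_two : forall A, mesh_elt k g A -> forall P Q, P != Q ->
    G `&` elt_bnd A = [set P; Q] ->
    exists i j, [/\ i != j, elt_edge A i P & elt_edge A j Q];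
  mr_smooth : forall A, mesh_elt k g A -> interface_elt A G ->
    exists gam : R -> pt R,
      C2_arc gam 0 1 /\ G `&` elt_set A = gam @` `[0, 1] }.

Definition tangent (R : realType) (D E : pt R) : pt R :=
  (enorm (E - D))^-1 *: (E - D).

(* The point with coordinates (xi, w xi) in the frame with origin D, first axis
   along the line DE and second axis along its unit normal nb. *)
Definition graph_pt (R : realType) (D E nb : pt R) (w : R -> R) (xi : R)
    : pt R := D + xi *: tangent D E + w xi *: nb.

Definition points_from_to (R : realType) (Om Op : set (pt R)) (X v : pt R)
    : Prop := \forall t \near (0 : R)^'+, Om (X - t *: v) /\ Op (X + t *: v).

(* nb is the unit normal of the line DE, and nrm X that of G at X. The
   orientation of nrm is prescribed at the points of G inside T; continuity
   carries it to D and E. *)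
Record local_geometry (R : realType) (k : fe_type) (A : 'I_(nloc k) -> pt R)
    (Om Op G : set (pt R)) (D E nb : pt R) (nrm : pt R -> pt R) : Prop :=
  LocalGeometry {
  lg_neq : D != E;
  lg_DE : G `&` elt_bnd A = [set D; E];
  lg_nb_unit : dot nb nb = 1;
  lg_nb_orth : dot nb (E - D) = 0;
  lg_nb_oriented : forall X, (G `&` interior (elt_set A)) X ->
    points_from_to Om Op X nb;
  lg_graph : exists w : R -> R,
    [/\ C2 w,
        G `&` elt_set A = graph_pt D E nb w @` `[0, enorm (E - D)],
        w 0 = 0 /\ w (enorm (E - D)) = 0,
        forall xi, 0 <= xi <= enorm (E - D) ->
          let n := nrm (graph_pt D E nb w xi) in
          dot n n = 1 /\ dot n (velocity (graph_pt D E nb w) xi) = 0 &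
        {within `[0, enorm (E - D)],
          continuous (nrm \o graph_pt D E nb w)}];
  lg_nrm_oriented : forall X, (G `&` interior (elt_set A)) X ->
    points_from_to Om Op X (nrm X) }.

(* The bounds on h are multiplied by kappa, which vanishes for a straight
   interface; they then hold trivially. *)
Record unisolvence (R : realType) (k : fe_type) (bm bp h kappa eps kb : R)
    : Prop := Unisolvence {
  us_eps : 0 < eps < Num.sqrt 2 / 2;
  us_kb : 0 < kb <= 1;
  us_h1 : h * (Num.sqrt 2 * (1 + (1 - 2 * eps ^+ 2) `^ (- (3 / 2))) * kappa)
          < Num.sqrt kb;
  us_h2 : h * kappa < eps;
  us_bilinear : k = Bilinear -> Num.sqrt kb < 1 / (4 * Num.sqrt 2);
  us_rotated : k = RotatedQ1 -> exists lam : R, 0 < lam < 1 /\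
    let rho := bm / bp in
    Num.sqrt kb <= rho * (1 - lam) / (4 - (3 + lam) * rho) }.

Definition proj_line (R : realType) (D nb X : pt R) : pt R :=
  X - dot (X - D) nb *: nb.

Definition admissible_F (R : realType) (k : fe_type) (D E nb : pt R)
    (nrm : pt R -> pt R) (F : pt R) : Prop :=
  match k with
  | Linear | CrouzeixRaviart => nrm F = nb
  | Bilinear => proj_line D nb F = 2^-1 *: (D + E)
  | RotatedQ1 => True
  end.

(* An element of Pi_T is given by its coefficients on this basis. *)
Definition basis_fun (R : realType) (k : fe_type) (j : nat) (X : pt R) : R :=
  match j with
  | 0 => 1
  | 1 => xc X
  | 2 => yc X
  | _ => if k is RotatedQ1 then xc X ^+ 2 - yc X ^+ 2 else xc X * yc X
  end.

Definition PiT (R : realType) (k : fe_type) := 'I_(nloc k) -> R.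

Definition pval (R : realType) (k : fe_type) (p : PiT R k) (X : pt R) : R :=
  \sum_j p j * basis_fun k j X.

Definition pd (R : realType) (k : fe_type) (p : PiT R k) (d : 'I_2)
    (X : pt R) : R := 'D_(unitv R d) (pval p : pt R -> R^o) X.

Definition pgrad (R : realType) (k : fe_type) (p : PiT R k) (X : pt R)
    : pt R := \col_d pd p d X.

(* The coefficient of the second degree term, for rectangular elements. *)
Definition deg2 (R : realType) (k : fe_type) (p : PiT R k) : R := p ord_max.

Record node_partition (R : realType) (k : fe_type) (A : 'I_(nloc k) -> pt R)
    (Om Op : set (pt R)) (Im Ip : {set 'I_(nloc k)}) : Prop := NodePartition {
  np_partition : forall i, (i \in Ip) = (i \notin Im);
  np_minus : forall i, i \in Im -> elt_part A Om (node A i);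
  np_plus : forall i, i \in Ip -> elt_part A Op (node A i) }.

(* phi_i is phim i on T^- and phip i on T^+. *)
Record ife_shape_functions (R : realType) (k : fe_type)
    (A : 'I_(nloc k) -> pt R) (bm bp : R) (D E F nF : pt R)
    (Im Ip : {set 'I_(nloc k)}) (phim phip : 'I_(nloc k) -> PiT R k) : Prop :=
  IfeShapeFunctions {
  ife_line : forall i X, line D E X -> pval (phim i) X = pval (phip i) X;
  ife_deg2 : is_rect k -> forall i, deg2 (phim i) = deg2 (phip i);
  ife_flux : forall i,
    bm * dot (pgrad (phim i) F) nF = bp * dot (pgrad (phip i) F) nF;
  ife_node_minus : forall i j, j \in Im ->
    pval (phim i) (node A j) = (i == j)%:R;
  ife_node_plus : forall i j, j \in Ip ->
    pval (phip i) (node A j) = (i == j)%:R }.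

Definition Nbar (R : realType) (nb : pt R) (b : R) (n : pt R) : 'M[R]_2 :=
  \matrix_(i < 2, j < 2)
    if i == 0 then (if j == 0 then yc nb else - xc nb)
    else (if j == 0 then b * xc n else b * yc n).

Definition Mbar_plus (R : realType) (nb : pt R) (bm bp : R) (n : pt R)
    : 'M[R]_2 := invmx (Nbar nb bm n) *m Nbar nb bp n.

Definition Mbar_minus (R : realType) (nb : pt R) (bm bp : R) (n : pt R)
    : 'M[R]_2 := invmx (Nbar nb bp n) *m Nbar nb bm n.

(* Main.v *)
(* If u = (u-, u+) is an IFE function, i.e. satisfies the conditions at l and F,
   then u = sum_i u(M_i) phi_i. Apply this to u = 1, and to the function equal
   to a coordinate a . X on one side of l and to a . X + ((M - I) a) . (X - D)
   on the other, where M = Mbar transfers the gradient at F; the second term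
   vanishes at each Xbar_i, so D may be replaced by Xbar_i. *)
Require Import Defs.
From HB Require Import structures.
From mathcomp Require Import all_boot all_order all_algebra.
From mathcomp Require Import all_classical all_reals all_analysis.
From mathcomp Require Import ring lra.

Set Implicit Arguments.
Unset Strict Implicit.
Unset Printing Implicit Defensive.

Import Order.TTheory GRing.Theory Num.Theory.
Import numFieldNormedType.Exports.

Local Open Scope classical_set_scope.
Local Open Scope ring_scope.

(** * Derivatives of the elements of Pi_T, and its affine members *)

Definition dbasis (R : realType) (k : fe_type) (d : 'I_2) (X : pt R) (j : nat)
    : R :=
  match j with
  | 0 => 0
  | 1 => (d == 0)%:R
  | 2 => (d == 1)%:R
  | _ => if k is RotatedQ1 then (if d == 0 then 2 * xc X else - (2 * yc X))
         else (if d == 0 then yc X else xc X)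
  end.

Lemma ord2_cases (d : 'I_2) : d = 0 \/ d = 1.
Proof. by case: d => [[|[|]]] // i; [left|right]; apply/val_inj. Qed.

Lemma xcB (R : realType) (X Y : pt R) : xc (X - Y) = xc X - xc Y.
Proof. by rewrite /xc !mxE. Qed.

Lemma ycB (R : realType) (X Y : pt R) : yc (X - Y) = yc X - yc Y.
Proof. by rewrite /yc !mxE. Qed.

Lemma pd_dbasis (R : realType) (k : fe_type) (p : PiT R k) (d : 'I_2)
    (X : pt R) : pd p d X = \sum_j p j * dbasis k d X j.
Proof.
(* [q j] is the [t ^ 2] coefficient of the increment of basis function [j] along [unitv R d]. It is
   nonzero only for [x^2 - y^2], since [xy] is affine in each variable. *)
pose q (j : nat) : R := if j is _.+3 then
  (if k is RotatedQ1 then (if d == 0 then 1 else -1) else 0) else 0.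
have basis_incr j (t : R) : basis_fun k j (t *: unitv R d + X) - basis_fun k j X
    = t * (dbasis k d X j + t * q j).
  rewrite /basis_fun /dbasis /q /xc /yc /unitv; case: (ord2_cases d) => ->;
  by move: j => [|[|[|j]]]; case: k {p q} => /=; rewrite ?mxE /=; ring.
rewrite /pd /derive; apply/cvg_lim; first exact: Rhausdorff.
(* For [t != 0] the difference quotient is this affine function of [t], whose limit at 0 is its
   constant term. *)
pose f (t : R) := \sum_j p j * dbasis k d X j + t * \sum_j p j * q j.
have f_cvg : f t @[t --> 0^'] --> \sum_j p j * dbasis k d X j.
  rewrite -[X in _ --> X]addr0 -[X in _ + X](mul0r (\sum_j p j * q j)).
  apply: cvgD; first exact: cvg_cst.
  apply: cvgM; last exact: cvg_cst.
  by apply: cvg_within_filter; exact: cvg_id.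
apply: cvg_trans f_cvg; apply: near_eq_cvg.
near=> t.
have t0 : t != 0 by near: t; exact: nbhs_dnbhs_neq.
rewrite /f /pval /= -sumrB mulr_sumr -big_split /= scaler_sumr.
apply: eq_bigr => j _.
by rewrite -mulrBr basis_incr /GRing.scale /=; field.
Unshelve. all: by end_near. Qed.

Definition affine_fun (R : realType) (k : fe_type) (c0 c1 c2 : R) : PiT R k :=
  fun j => match val j with 0 => c0 | 1 => c1 | 2 => c2 | _ => 0 end.
Arguments affine_fun {R} k c0 c1 c2.

Lemma affine_fun_sum (R : realType) (k : fe_type) (c0 c1 c2 : R)
    (b : nat -> R) :
  \sum_j affine_fun k c0 c1 c2 j * b j = c0 * b 0 + c1 * b 1 + c2 * b 2.
Proof.
by case: k; rewrite /nloc /= !big_ord_recl big_ord0 /affine_fun /= /bump /=;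
  ring.
Qed.

Lemma pval_affine (R : realType) (k : fe_type) (c0 c1 c2 : R) (X : pt R) :
  pval (affine_fun k c0 c1 c2) X = c0 + c1 * xc X + c2 * yc X.
Proof.
by rewrite /pval (affine_fun_sum _ _ _ _ (basis_fun k ^~ X)) /= mulr1.
Qed.

Lemma dot_pgrad (R : realType) (k : fe_type) (p : PiT R k) (X n : pt R) :
  dot (pgrad p X) n =
  \sum_j p j * (dbasis k 0 X j * xc n + dbasis k 1 X j * yc n).
Proof.
rewrite /dot [xc (pgrad _ _)]mxE [yc (pgrad _ _)]mxE !pd_dbasis.
rewrite !mulr_suml -big_split /=.
by apply: eq_bigr => j _; ring.
Qed.

Lemma dot_pgrad_affine (R : realType) (k : fe_type) (c0 c1 c2 : R)
    (X n : pt R) :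
  dot (pgrad (affine_fun k c0 c1 c2) X) n = c1 * xc n + c2 * yc n.
Proof.
rewrite dot_pgrad.
rewrite (affine_fun_sum _ _ _ _
  (fun j => dbasis k 0 X j * xc n + dbasis k 1 X j * yc n)) /=; ring.
Qed.

Lemma affine_of_deg2 (R : realType) (k : fe_type) (p : PiT R k) :
  (is_rect k -> deg2 p = 0) -> exists c0 c1 c2, p =1 affine_fun k c0 c1 c2.
Proof.
case: k p => p; rewrite /deg2 /= => p0;
exists (p ord0), (p (inord 1)), (p (inord 2)) => j; rewrite /affine_fun;
(* A triangle has only the indices 0, 1, 2; on a rectangle the remaining index 3 is [ord_max], where
   [p0] applies. *)
case: j => [[|[|[|[|j]]]] jP] //=;
rewrite -?[RHS]p0 //; congr (p _); apply/val_inj; rewrite /= ?inordK //.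
Qed.

(** * IFE functions and their jump across the line [DE] *)

Record ife_function (R : realType) (k : fe_type) (b1 b2 : R) (D E F n : pt R)
    (u1 u2 : PiT R k) : Prop := IfeFunction {
  ifun_line : forall X, line D E X -> pval u1 X = pval u2 X;
  ifun_deg2 : is_rect k -> deg2 u1 = deg2 u2;
  ifun_flux : b1 * dot (pgrad u1 F) n = b2 * dot (pgrad u2 F) n }.

(** In the plane, [r] and [nb] are both orthogonal to [v != 0], hence parallel, and [r] equals its
    projection onto the unit vector [nb]. *)
Lemma orth_line (R : realType) (nb v r : pt R) :
  dot nb nb = 1 -> dot nb v = 0 -> v != 0 -> dot r v = 0 ->
  xc r = dot r nb * xc nb /\ yc r = dot r nb * yc nb.
Proof.
rewrite /dot => nb1 nbv v0 rv.
have vv : xc v * xc v + yc v * yc v != 0.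
  apply: contra_neq v0 => vv; apply/matrixP => i j; rewrite ord1 mxE.
  move/eqP: vv; rewrite paddr_eq0 -?expr2 ?sqr_ge0 // !sqrf_eq0.
  by case/andP => /eqP x0 /eqP y0; case: (ord2_cases i) => ->.
(* Multiplied by [dot v v], the cross product of [r] and [nb] is a combination of [dot r v] and
   [dot nb v]. *)
have cross : xc r * yc nb - yc r * xc nb = 0.
  apply: (mulfI vv); rewrite mulr0.
  transitivity ((xc r * xc v + yc r * yc v) * (yc nb * xc v - xc nb * yc v)
    + (xc nb * xc v + yc nb * yc v) * (xc r * yc v - yc r * xc v)); first ring.
  by rewrite rv nbv; ring.
split; rewrite -[LHS]mulr1 -nb1.
  transitivity ((xc r * xc nb + yc r * yc nb) * xc nb
    + (xc r * yc nb - yc r * xc nb) * yc nb); first ring.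
  by rewrite cross; ring.
transitivity ((xc r * xc nb + yc r * yc nb) * yc nb
  - (xc r * yc nb - yc r * xc nb) * xc nb); first ring.
by rewrite cross; ring.
Qed.

Section InterfaceLine.
Variables (R : realType) (k : fe_type) (A : 'I_(nloc k) -> pt R).
Variables (b1 b2 : R) (D E F nb n : pt R).
Hypotheses (b2_neq0 : b2 != 0) (DE : D != E) (nb1 : dot nb nb = 1).
Hypotheses (nbDE : dot nb (E - D) = 0) (nbn : dot nb n != 0).

(** The solution [c] of [b2 * (g + c * dot nb n) = b1 * g]: if [g] is the derivative along [n] on
    side 1, the flux condition makes the gradient jump by [c *: nb]. *)
Definition jump_slope (g : R) : R := (b1 / b2 - 1) * g / dot nb n.

(** The second degree terms agree, so [u2 - u1] is affine. It vanishes at [D] and [E], so its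
    gradient is a multiple of [nb], and the flux condition at [F] fixes the factor. *)
Lemma ife_function_jump (u1 u2 : PiT R k) :
  ife_function b1 b2 D E F n u1 u2 -> forall X,
  pval u2 X =
  pval u1 X + jump_slope (dot (pgrad u1 F) n) * dot nb (X - D).
Proof.
case=> u_line u_deg2 u_flux X.
have [|c0 [c1 [c2 rE]]] := @affine_of_deg2 R k (fun j => u2 j - u1 j).
  by move=> krect; apply/eqP; rewrite subr_eq0; apply/eqP/esym/u_deg2.
have sumE (b : nat -> R) :
    \sum_j u2 j * b j = \sum_j u1 j * b j + (c0 * b 0 + c1 * b 1 + c2 * b 2).
  rewrite -(affine_fun_sum k) -big_split /=; apply: eq_bigr => j _.
  by rewrite -rE; ring.
have valE Y : pval u2 Y = pval u1 Y + (c0 + c1 * xc Y + c2 * yc Y).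
  by rewrite /pval (sumE (basis_fun k ^~ Y)) /= mulr1.
have gradE : dot (pgrad u2 F) n = dot (pgrad u1 F) n + (c1 * xc n + c2 * yc n).
  rewrite !dot_pgrad.
  by rewrite (sumE (fun j => dbasis k 0 F j * xc n + dbasis k 1 F j * yc n)) /=;
    ring.
have rD : c0 + c1 * xc D + c2 * yc D = 0.
  apply: (addrI (pval u1 D)); rewrite -valE addr0; apply/esym/u_line.
  by exists 0 => //; rewrite scale0r addr0.
have rEnd : c0 + c1 * xc E + c2 * yc E = 0.
  apply: (addrI (pval u1 E)); rewrite -valE addr0; apply/esym/u_line.
  by exists 1 => //; rewrite scale1r addrC subrK.
pose r := mkpt c1 c2.
have xr : xc r = c1 by rewrite /xc mxE.
have yr : yc r = c2 by rewrite /yc mxE.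
have ED : E - D != 0 by rewrite subr_eq0 eq_sym.
have rED : dot r (E - D) = 0.
  rewrite /dot xr yr xcB ycB -[RHS](subrr 0) -{1}rEnd -rD; ring.
have [c1E c2E] := orth_line nb1 nbDE ED rED.
rewrite xr in c1E; rewrite yr in c2E.
have cE : dot r nb = jump_slope (dot (pgrad u1 F) n).
  apply: (mulIf nbn); rewrite /jump_slope divfK //.
  apply: (mulfI b2_neq0).
  have -> : dot r nb * dot nb n = c1 * xc n + c2 * yc n.
    by rewrite c1E c2E {2}/dot; ring.
  apply: (addrI (b2 * dot (pgrad u1 F) n)).
  rewrite -mulrDr -gradE -u_flux; by field.
rewrite valE -cE; congr (_ + _).
transitivity (c1 * (xc X - xc D) + c2 * (yc X - yc D)).
  by rewrite -[LHS]subr0 -rD; ring.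
by rewrite {2}/dot xcB ycB {1}c1E {1}c2E; ring.
Qed.

(** * Expansion of IFE functions in the shape functions *)

Variables (I1 I2 : {set 'I_(nloc k)}) (phi1 phi2 : 'I_(nloc k) -> PiT R k).
Hypotheses (I12 : forall i, (i \in I2) = (i \notin I1)).
Hypothesis phi : ife_shape_functions A b1 b2 D E F n I1 I2 phi1 phi2.

(* By the jump formula, the degrees of freedom of an IFE function are linear in
   the n coefficients of its first piece. Hence phi_i(M_j) = delta_ij says that
   the coefficient matrix of the first pieces is a one-sided inverse of a square
   matrix, thus a two-sided one: unisolvence follows from existence. *)
Lemma ife_function_expansion (u1 u2 : PiT R k) :
  ife_function b1 b2 D E F n u1 u2 -> forall j,
  \sum_i (if i \in I2 then pval u2 (node A i) else pval u1 (node A i))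
         * phi1 i j = u1 j.
Proof.
move=> hu j.
pose ev : 'M[R]_(nloc k) := \matrix_(j', i) (basis_fun k j' (node A i)
  + if i \in I2 then
      jump_slope (dbasis k 0 F j' * xc n + dbasis k 1 F j' * yc n)
      * dot nb (node A i - D) else 0).
pose Phi : 'M[R]_(nloc k) := \matrix_(i, j') phi1 i j'.
have evE (v1 v2 : PiT R k) i : ife_function b1 b2 D E F n v1 v2 ->
    \sum_j' v1 j' * ev j' i =
    if i \in I2 then pval v2 (node A i) else pval v1 (node A i).
  move=> hv; rewrite (ife_function_jump hv) dot_pgrad /pval.
  under eq_bigr do rewrite mxE.
  case: ifP => _; last by apply: eq_bigr => j' _; rewrite addr0.
  rewrite /jump_slope mulr_sumr !mulr_suml -big_split /=.
  by apply: eq_bigr => j' _; ring.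
have Phi_ev : Phi *m ev = 1%:M.
  apply/matrixP => i i'; rewrite !mxE.
  under eq_bigr do rewrite mxE.
  case: phi => pl pd2 pf pm pp.
  rewrite (evE (phi1 i) (phi2 i)); last first.
    by split; [exact: pl|move=> kr; exact: pd2|exact: pf].
  by case: ifPn => [/pp//|]; rewrite I12 negbK => /pm.
have : (\row_j' u1 j' *m ev *m Phi) 0 j = u1 j.
  by rewrite -mulmxA (mulmx1C Phi_ev) mulmx1 mxE.
rewrite mxE => <-; apply: eq_bigr => i _; rewrite !mxE; congr (_ * _).
by rewrite -(evE _ _ _ hu); apply: eq_bigr => j' _; congr (_ * _); rewrite mxE.
Qed.

(** The sequence [b] stands for a linear functional on coefficients: [basis_fun] at [X] yields
    values and [dbasis] yields derivatives, so one computation serves both kinds of identities. *)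
Lemma ife_function_reproduction (u1 u2 : PiT R k) (b : nat -> R) :
  ife_function b1 b2 D E F n u1 u2 ->
  \sum_i (\sum_j phi1 i j * b j)
         * (if i \in I2 then pval u2 (node A i) else pval u1 (node A i))
  = \sum_j u1 j * b j.
Proof.
move=> hu; under [RHS]eq_bigr do rewrite -(ife_function_expansion hu) mulr_suml.
rewrite exchange_big /=; apply: eq_bigr => i _.
by rewrite mulr_suml; apply: eq_bigr => j _; ring.
Qed.

Lemma shape_sum (b : nat -> R) : \sum_i \sum_j phi1 i j * b j = b 0.
Proof.
have one : ife_function b1 b2 D E F n
    (affine_fun k 1 0 0) (affine_fun k 1 0 0).
  by split=> //; rewrite !dot_pgrad_affine; ring.
have := ife_function_reproduction b one.
rewrite affine_fun_sum !mul0r !addr0 mul1r => <-; apply: eq_bigr => i _.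
by rewrite if_same pval_affine !mul0r !addr0 mulr1.
Qed.

(** * The gradient transfer matrix and first moments *)

Lemma Nbar_unit : Nbar nb b2 n \in unitmx.
Proof.
rewrite unitmxE unitfE (expand_det_row _ 0) !big_ord_recl big_ord0.
rewrite /cofactor !det_mx11 !mxE /=.
rewrite (_ : _ + _ = b2 * dot nb n); last by rewrite /dot; ring.
by rewrite mulf_neq0.
Qed.

(* The columns of Mbar_minus: the gradient across the interface of the IFE
   function that restricts to a coordinate on the first side. *)
Lemma Mbar_minus_col (e : 'I_2) : let M := Mbar_minus nb b1 b2 n in
  yc nb * (M 0 e - (e == 0)%:R) - xc nb * (M 1 e - (e == 1)%:R) = 0 /\
  b2 * (M 0 e * xc n + M 1 e * yc n)
  = b1 * ((e == 0)%:R * xc n + (e == 1)%:R * yc n).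
Proof.
move=> M.
have NM : Nbar nb b2 n *m M = Nbar nb b1 n by rewrite /M mulKVmx // Nbar_unit.
(* In column [e] of [NM], row 0 is continuity of the tangential derivative along [DE] and row 1 is
   continuity of the flux. *)
move: M NM => M /(congr1 (fun B : 'M[R]_2 => (B 0 e, B 1 e))).
rewrite !mxE !big_ord_recl !big_ord0 !mxE /= => -[].
have -> : lift ord0 ord0 = 1 :> 'I_2 by apply/val_inj.
have -> : ord0 = 0 :> 'I_2 by [].
by case: (ord2_cases e) => -> /= r0 r1; split; lra.
Qed.

Variables (Xbar : 'I_(nloc k) -> pt R).
Hypothesis hXbar : forall i, line D E (Xbar i).

(** Component [e] is the reproduction formula for the IFE function that restricts to coordinate [e]
    on side 1. *)
Lemma shape_first_moments (b : nat -> R) :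
  \sum_i (\sum_j phi1 i j * b j) *: node A i
  + \sum_(i in I2) (\sum_j phi1 i j * b j) *:
      ((Mbar_minus nb b1 b2 n - 1%:M)^T *m (node A i - Xbar i))
  = mkpt (b 1) (b 2).
Proof.
set M := Mbar_minus nb b1 b2 n.
apply/matrixP => e z; rewrite ord1 {z}.
move: M (Mbar_minus_col e : let M' := M in _) => M [M_tan M_flux].
(* Column [e] of [M - 1], the gradient jump; because of the transpose, component [e] of the
   correction term is a dot product with [B]. *)
pose B := mkpt (M 0 e - (e == 0)%:R) (M 1 e - (e == 1)%:R).
have B0 : xc B = M 0 e - (e == 0)%:R by rewrite /xc mxE.
have B1 : yc B = M 1 e - (e == 1)%:R by rewrite /yc mxE.
have B_line X : line D E X -> dot B (X - D) = 0.
  case=> t _ <-; rewrite addrC addKr.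
  have -> : dot B (t *: (E - D)) = t * dot B (E - D).
    by rewrite /dot {2}/xc {3}/yc !mxE /xc /yc !mxE; ring.
  (* The factor 1 is written as [dot nb nb] in order to expand [dot B (E - D)] along [nb] and its
     perpendicular. The first part vanishes by [nbDE], the second by [M_tan]. *)
  apply: (mulIf (oner_neq0 R)); rewrite mul0r -[X in _ * X]nb1.
  transitivity (t * ((dot B nb * dot nb (E - D))
    + (yc nb * xc B - xc nb * yc B)
      * (yc nb * xc (E - D) - xc nb * yc (E - D)))).
    by rewrite /dot; ring.
  by rewrite nbDE B0 B1 M_tan; ring.
pose u1 := affine_fun k 0 (e == 0)%:R (e == 1)%:R : PiT R k.
pose u2 := affine_fun k (- dot B D) (M 0 e) (M 1 e) : PiT R k.
have coordE (X : pt R) : X e 0 = (e == 0)%:R * xc X + (e == 1)%:R * yc X :> R.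
  by case: (ord2_cases e) => ->; rewrite /xc /yc /=; ring.
have u1E X : pval u1 X = X e 0 by rewrite pval_affine coordE add0r.
have u2E X : pval u2 X = X e 0 + dot B (X - D).
  by rewrite pval_affine coordE /dot xcB ycB B0 B1; ring.
have hu : ife_function b1 b2 D E F n u1 u2.
  split.
  - by move=> X hX; rewrite u1E u2E B_line // addr0.
  - by rewrite /deg2 /u1 /u2; case: (k).
  - by rewrite !dot_pgrad_affine M_flux.
have -> : mkpt (b 1) (b 2) e 0 = \sum_j u1 j * b j.
  by rewrite affine_fun_sum mxE; case: (ord2_cases e) => -> /=; ring.
rewrite -(ife_function_reproduction b hu) mxE !summxE.
rewrite [X in _ + X]big_mkcond -big_split /=; apply: eq_bigr => i _.
rewrite u1E u2E mxE; case: ifP => _; last by rewrite addr0.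
rewrite [X in _ + X]mxE -mulrDr; congr (_ * (_ + _)).
rewrite mxE !big_ord_recl big_ord0.
have -> : lift ord0 ord0 = 1 :> 'I_2 by apply/val_inj.
transitivity (dot B (node A i - Xbar i)).
  rewrite /dot B0 B1 /xc /yc !mxE addr0.
  by rewrite ![_ == e]eq_sym.
have := B_line _ (hXbar i); rewrite /dot !xcB !ycB => BX.
by rewrite -[LHS]addr0 -BX; ring.
Qed.

End InterfaceLine.

(** * The identities for one side of the interface *)

Lemma mkpt_xy (R : realType) (X : pt R) : mkpt (xc X) (yc X) = X.
Proof.
by apply/matrixP => i j; rewrite ord1 mxE; case: (ord2_cases i) => ->.
Qed.

Lemma shape_identities (R : realType) (k : fe_type) (A : 'I_(nloc k) -> pt R)
    (b1 b2 : R) (D E F nb n : pt R) (I1 I2 : {set 'I_(nloc k)})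
    (phi1 phi2 : 'I_(nloc k) -> PiT R k) (Xbar : 'I_(nloc k) -> pt R) :
  b2 != 0 -> D != E -> dot nb nb = 1 -> dot nb (E - D) = 0 ->
  dot nb n != 0 -> (forall i, (i \in I2) = (i \notin I1)) ->
  ife_shape_functions A b1 b2 D E F n I1 I2 phi1 phi2 ->
  (forall i, line D E (Xbar i)) ->
  let B := (Mbar_minus nb b1 b2 n - 1%:M)^T in
  (forall X, \sum_i pval (phi1 i) X *: (node A i - X)
     + \sum_(i in I2) pval (phi1 i) X *: (B *m (node A i - Xbar i)) = 0) /\
  (forall d X, \sum_i pd (phi1 i) d X *: (node A i - X)
     + \sum_(i in I2) pd (phi1 i) d X *: (B *m (node A i - Xbar i))
     - unitv R d = 0).
Proof.
move=> b2_neq0 DE nb1 nbDE nbn I12 phi hXbar B.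
have sum0 := shape_sum b2_neq0 DE nb1 nbDE nbn I12 phi.
have sum1 := shape_first_moments b2_neq0 DE nb1 nbDE nbn I12 phi hXbar.
(* The terms in [X] sum to [b 0 *: X]. Evaluation at [X] makes the right side [X - X]; the
   derivative has [b 0 = 0] and leaves the unit vector. *)
have identity (b : nat -> R) X :
    \sum_i (\sum_j phi1 i j * b j) *: (node A i - X)
    + \sum_(i in I2) (\sum_j phi1 i j * b j) *: (B *m (node A i - Xbar i))
    = mkpt (b 1) (b 2) - b 0 *: X.
  under eq_bigr do rewrite scalerBr.
  by rewrite sumrB -scaler_suml sum0 addrAC sum1.
split=> [X|d X].
  by rewrite /pval (identity (basis_fun k ^~ X)) /= mkpt_xy scale1r subrr.
under eq_bigr do rewrite pd_dbasis.
under [X in _ + X - _]eq_bigr do rewrite pd_dbasis.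
rewrite (identity (dbasis k d X)) /= scale0r subr0.
apply/eqP; rewrite subr_eq0; apply/eqP.
apply/matrixP => i j; rewrite ord1 !mxE /= andbT.
by case: (ord2_cases d) => ->; case: (ord2_cases i) => ->.
Qed.

(** * Nondegeneracy of the interface normal against [nb] *)

Lemma derive1_affine_graph (R : realType) (w : R -> R) (a b c xi : R) :
  derivable w xi 1 ->
  derive1 (fun x => a + x * b + w x * c) xi = b + derive1 w xi * c.
Proof.
move=> w_der; rewrite !derive1E.
have w_is := derivableP w_der.
rewrite (_ : (fun x => _) = cst a + (id * cst b) + (w * cst c)) //.
by rewrite derive_val /GRing.scale /=; ring.
Qed.

Lemma velocity_graph (R : realType) (D E nb : pt R) (w : R -> R) (xi : R) :
  derivable w xi 1 ->
  velocity (graph_pt D E nb w) xi = tangent D E + derive1 w xi *: nb.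
Proof.
move=> w_der; apply/matrixP => i j; rewrite ord1 {j}.
rewrite [RHS]mxE [X in _ + X]mxE -(derive1_affine_graph (D i 0)) //.
by rewrite mxE; case: (ord2_cases i) => -> /=; congr (derive1 _ xi);
  apply/funext => x;
  rewrite /xcoord /ycoord /xc /yc /graph_pt mxE [X in X + _]mxE
    [X in _ + X + _]mxE [X in _ + X]mxE.
Qed.

(** The velocity is [tangent D E] plus a multiple of [nb]. If [n] were orthogonal to [nb], it would
    also be orthogonal to [E - D], hence zero, which contradicts unit length. *)
Lemma graph_normal (R : realType) (D E nb n : pt R) (w : R -> R) (xi : R) :
  derivable w xi 1 -> D != E -> dot nb nb = 1 -> dot nb (E - D) = 0 ->
  dot n n = 1 -> dot n (velocity (graph_pt D E nb w) xi) = 0 ->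
  dot nb n != 0.
Proof.
move=> w_der DE nb1 nbDE n1 nv; apply/negP => /eqP nbn.
have ED : E - D != 0 by rewrite subr_eq0 eq_sym.
have nnb : dot n nb = 0 by rewrite -nbn /dot; ring.
have nED : dot n (E - D) = 0.
  have norm_neq0 : enorm (E - D) != 0.
    apply: contra_neq ED => /eqP; rewrite /enorm sqrtr_eq0 /dot => le0.
    have : xc (E - D) ^+ 2 + yc (E - D) ^+ 2 == 0.
      by rewrite eq_le !expr2 le0 addr_ge0 // -expr2 sqr_ge0.
    rewrite paddr_eq0 ?sqr_ge0 // !sqrf_eq0 => /andP[/eqP x0 /eqP y0].
    by rewrite -[E - D]mkpt_xy x0 y0; apply/matrixP => i j;
      rewrite !mxE if_same.
  move: nv; rewrite velocity_graph //.
  have -> : dot n (tangent D E + derive1 w xi *: nb)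
      = (enorm (E - D))^-1 * dot n (E - D) + derive1 w xi * dot n nb.
    by rewrite /dot /tangent /xc /yc !mxE; ring.
  by rewrite nnb mulr0 addr0 => /eqP; rewrite mulf_eq0 invr_eq0
    (negbTE norm_neq0) /= => /eqP.
have [xn yn] := orth_line nb1 nbDE ED nED.
by move/eqP: n1; rewrite /dot xn yn nnb !mul0r addr0 eq_sym oner_eq0.
Qed.

Theorem theorem5p3 (R : realType) (k : fe_type)
  (Omega Om Op G : set (pt R)) (kappa : R)
  (hInterface : interface Omega Om Op G kappa)
  (g : grid R) (h : R)
  (hMesh : cartesian_mesh k Omega g h)
  (hResolves : mesh_resolves k g G)
  (bm bp : R) (hbm : 0 < bm) (hbp : 0 < bp) (hb : bm <= bp)
  (eps kb : R) (hUnisolvence : unisolvence k bm bp h kappa eps kb)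
  (A : 'I_(nloc k) -> pt R) (hA : mesh_elt k g A) (hAi : interface_elt A G)
  (D E nb : pt R) (nrm : pt R -> pt R)
  (hGeometry : local_geometry A Om Op G D E nb nrm)
  (F : pt R) (hF : (G `&` elt_set A) F) (hF' : admissible_F k D E nb nrm F)
  (Im Ip : {set 'I_(nloc k)}) (hPart : node_partition A Om Op Im Ip)
  (phim phip : 'I_(nloc k) -> PiT R k)
  (hphi : ife_shape_functions A bm bp D E F (nrm F) Im Ip phim phip)
  (Xbar : 'I_(nloc k) -> pt R) (hXbar : forall i, line D E (Xbar i)) :
  [/\ forall X, elt_part A Om X ->
        \sum_i pval (phim i) X *: (node A i - X)
        + \sum_(i in Ip) pval (phim i) X *:
            ((Mbar_minus nb bm bp (nrm F) - 1%:M)^T *m (node A i - Xbar i))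
        = 0,
      forall X, elt_part A Op X ->
        \sum_i pval (phip i) X *: (node A i - X)
        + \sum_(i in Im) pval (phip i) X *:
            ((Mbar_plus nb bm bp (nrm F) - 1%:M)^T *m (node A i - Xbar i))
        = 0,
      forall (d : 'I_2) X, elt_part A Om X ->
        \sum_i pd (phim i) d X *: (node A i - X)
        + \sum_(i in Ip) pd (phim i) d X *:
            ((Mbar_minus nb bm bp (nrm F) - 1%:M)^T *m (node A i - Xbar i))
        - unitv R d = 0
    & forall (d : 'I_2) X, elt_part A Op X ->
        \sum_i pd (phip i) d X *: (node A i - X)
        + \sum_(i in Im) pd (phip i) d X *:
            ((Mbar_plus nb bm bp (nrm F) - 1%:M)^T *m (node A i - Xbar i))
        - unitv R d = 0].
Proof.
case: hGeometry => DE _ nb1 nbDE _ [w [[w_der _ _] GE _ nrm_w _]] _.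
have nbn : dot nb (nrm F) != 0.
  move: hF; rewrite GE => -[xi xiI FE].
  have [] := nrm_w xi; first by move: xiI; rewrite /= in_itv.
  by rewrite FE; exact: graph_normal.
case: hPart => part _ _.
have part' i : (i \in Im) = (i \notin Ip) by rewrite part negbK.
(* The IFE conditions are symmetric under exchange of the two sides. *)
have hphi' : ife_shape_functions A bp bm D E F (nrm F) Ip Im phip phim.
  case: hphi => pl pd2 pf pm pp; split=> //.
  - by move=> i X hX; rewrite pl.
  - by move=> kr i; rewrite pd2.
have [idm derm] :=
  shape_identities (lt0r_neq0 hbp) DE nb1 nbDE nbn part hphi hXbar.
(* With the sides exchanged, [Mbar_minus nb bp bm] is by definition [Mbar_plus nb bm bp]. *)
have [idp derp] :=
  shape_identities (lt0r_neq0 hbm) DE nb1 nbDE nbn part' hphi' hXbar.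
by split=> [X _|X _|d X _|d X _];
  [exact: idm|exact: idp|exact: derm|exact: derp].
Qed.
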